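(* Let $(G,\sigma)$ be a signed graph and $t,k\ge 0$ integers. Then $\chi_{sym}(G,\sigma)= t+2k$ with $t$ the maximum integer in $\{0,\dots,\chi(G)\}$ such that $\chi_{sym}^t(G,\sigma)=\chi_{sym}(G,\sigma)$, if and only if $(G,\sigma)$ can be partitioned into $t$ independent sets and $k$ non-bipartite antibalanced (induced) subgraphs such that $t+2k$ is minimum and $t$ is maximum for such a partition (i.e. $t+2k$ is minimum among all partitions of $V(G)$ into independent sets and vertex sets inducing non-bipartite antibalanced subgraphs, where $t$ counts the former and $k$ the latter, and among those attaining this minimum the number $t$ of independent sets is maximum).
   Context: Graphs are finite multigraphs without loops (parallel edges allowed); $\chi(G)$ is the ordinary chromatic number. A signed graph $(G,\sigma)$ is a graph $G$ with a signature $\sigma:E(G)\to\{+,-\}$. Switching at $X\subseteq V(G)$ reverses the sign of every edge with exactly one end in $X$; two signed graphs on $G$ are equivalent if one is obtained from the other by switching at some vertex set. A signed graph is antibalanced if it is equivalent to the signed graph with all edges negative. A subgraph of $(G,\sigma)$ carries the restricted signature. A symmetric set is a set $S$ with an involution $s\mapsto -s$ on $S$; $s$ is self-inverse if $s=-s$. $S_{2k}^t$ ($t,k\ge 0$) is the symmetric set with exactly $t$ self-inverse elements $0_1,\dots,0_t$ and $2k$ non-self-inverse elements $\pm s_1,\dots,\pm s_k$. A proper $S_{2k}^t$-coloring of $(G,\sigma)$ is a map $c:V(G)\to S_{2k}^t$ with $c(v)\ne\sigma(e)c(w)$ for every edge $e=vw$. For $t\in\{0,\dots,\chi(G)\}$,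 $\chi_{sym}^t(G,\sigma)$ is the minimum of $t+2k$ over all $k\ge0$ for which $(G,\sigma)$ has a proper $S_{2k}^t$-coloring. The symset chromatic number is $\chi_{sym}(G,\sigma)=\min\{\chi_{sym}^t(G,\sigma): 0\le t\le\chi(G)\}$. *)

(* Defs.v *)
From HB Require Import structures.
From mathcomp Require Import all_boot.

Set Implicit Arguments.
Unset Strict Implicit.
Unset Printing Implicit Defensive.

(* Finite loopless multigraphs: every edge has a two-element set of ends, and
   distinct edges may have the same ends. *)
Record mgraph := MGraph {
  vert : finType;
  edge : finType;
  ends : edge -> {set vert};
  card_ends : forall e : edge, #|ends e| = 2
}.

Definition independent (G : mgraph) (X : {set vert G}) : bool :=
  [forall e : edge G, ~~ (ends e \subset X)].

Definition bipartite (G : mgraph) : bool :=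
  [exists A : {set vert G}, independent A && independent (~: A)].

Definition proper_coloring (G : mgraph) (T : finType)
    (c : {ffun vert G -> T}) : bool :=
  [forall e : edge G, forall v : vert G, forall w : vert G,
     (ends e == [set v; w]) ==> (c v != c w)].

Definition colorable (G : mgraph) (n : nat) : bool :=
  [exists c : {ffun vert G -> 'I_n}, proper_coloring c].

Lemma ends_neq (G : mgraph) (e : edge G) (v w : vert G) :
  ends e = [set v; w] -> v != w.
Proof.
by move=> E; have := card_ends e; rewrite E cards2; case: (v != w).
Qed.

Lemma colorable_exists (G : mgraph) : exists n, colorable G n.
Proof.
exists #|vert G|; apply/existsP; exists [ffun v => enum_rank v].
apply/forallP=> e; apply/forallP=> v; apply/forallP=> w.
apply/implyP=> /eqP/ends_neq; rewrite !ffunE.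
by apply: contra => /eqP/enum_rank_inj->.
Qed.

Definition chi (G : mgraph) : nat := ex_minn (colorable_exists G).

(* Signs are booleans: [true] is the sign -, [false] is the sign +. *)
Notation signature G := {ffun edge G -> bool}.

Definition switch (G : mgraph) (X : {set vert G}) (sigma : signature G) :
    signature G :=
  [ffun e => sigma e (+) (#|ends e :&: X| == 1)].

Definition sig_equiv (G : mgraph) (sigma tau : signature G) : bool :=
  [exists X : {set vert G}, switch X sigma == tau].

Definition antibalanced (G : mgraph) (sigma : signature G) : bool :=
  sig_equiv sigma [ffun=> true].

Section Induced.
Variables (G : mgraph) (X : {set vert G}).

Definition ivert : finType := {v : vert G | v \in X}.
Definition iedge : finType := {e : edge G | ends e \subset X}.
Definition iends (e : iedge) : {set ivert} :=
  [set v : ivert | val v \in ends (val e)].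

Lemma card_iends (e : iedge) : #|iends e| = 2.
Proof.
rewrite -(card_ends (val e)) -(card_imset _ val_inj).
apply: eq_card => v; apply/imsetP/idP => [[u]|ve].
  by rewrite inE => ue ->.
by exists (Sub v (subsetP (valP e) v ve)); rewrite ?inE SubK.
Qed.

Definition induced : mgraph := MGraph card_iends.

Definition sig_induced (sigma : signature G) : signature induced :=
  [ffun e : iedge => sigma (val e)].
End Induced.

Definition nonbip_antibalanced (G : mgraph) (sigma : signature G)
    (X : {set vert G}) : bool :=
  ~~ bipartite (induced X) && antibalanced (sig_induced X sigma).

Record symset := SymSet {
  selt :> finType;
  sopp : selt -> selt;
  soppK : involutive sopp
}.

Definition sact (S : symset) (b : bool) (s : S) : S :=
  if b then sopp s else s.

Definition std_opp (t k : nat) (s : 'I_t + 'I_k * bool) : 'I_t + 'I_k * bool :=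
  match s with
  | inl i => inl i
  | inr (j, b) => inr (j, ~~ b)
  end.

Lemma std_oppK (t k : nat) : involutive (@std_opp t k).
Proof. by case=> [//|[j b]] /=; rewrite negbK. Qed.

(* $S_{2k}^t$: [inl i] is self-inverse, and [inr (j, false)], [inr (j, true)]
   are the pair $s_j$, $-s_j$. *)
Definition std_symset (t k : nat) : symset := SymSet (@std_oppK t k).

Definition proper_sym_coloring (G : mgraph) (sigma : signature G) (S : symset)
    (c : {ffun vert G -> S}) : bool :=
  [forall e : edge G, forall v : vert G, forall w : vert G,
     (ends e == [set v; w]) ==> (c v != sact (sigma e) (c w))].

Definition sym_colorable (G : mgraph) (sigma : signature G) (t k : nat) : bool :=
  [exists c : {ffun vert G -> std_symset t k}, proper_sym_coloring sigma c].

Lemma sym_colorable_exists (G : mgraph) (sigma : signature G) (t : nat) :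
  exists n, [exists k : 'I_n.+1, (n == t + 2 * k) && sym_colorable sigma t k].
Proof.
pose k := #|vert G|; exists (t + 2 * k); apply/existsP.
have kP : k < (t + 2 * k).+1 by rewrite ltnS mul2n -addnn addnA leq_addl.
exists (Ordinal kP); rewrite eqxx /=; apply/existsP.
exists [ffun v => inr (enum_rank v, false)].
apply/forallP=> e; apply/forallP=> v; apply/forallP=> w.
apply/implyP=> /eqP/ends_neq; rewrite !ffunE /sact.
by apply: contra; case: (sigma e) => /eqP // [] /enum_rank_inj->.
Qed.

Definition chi_symt (G : mgraph) (sigma : signature G) (t : nat) : nat :=
  ex_minn (sym_colorable_exists sigma t).

(* The initial value is the term of index 0, which lies in the range, so this
   is the minimum over $0 \le t \le \chi(G)$. *)
Definition chi_sym (G : mgraph) (sigma : signature G) : nat :=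
  \big[minn/chi_symt sigma 0]_(t < (chi G).+1) chi_symt sigma t.

(* The two kinds of blocks exclude each other, since an independent set induces
   a bipartite graph. *)
Definition has_partition (G : mgraph) (sigma : signature G) (t k : nat) : Prop :=
  exists P : {set {set vert G}},
    [/\ partition P [set: vert G],
        forall X, X \in P -> independent X || nonbip_antibalanced sigma X,
        #|[set X in P | independent X]| = t
      & #|[set X in P | nonbip_antibalanced sigma X]| = k].

(* Main.v *)
Require Import Defs.
From HB Require Import structures.
From mathcomp Require Import all_boot.
From mathcomp Require Import zify.

Set Implicit Arguments.
Unset Strict Implicit.
Unset Printing Implicit Defensive.

(** In a symmetric coloring, the vertices colored by a self-inverse element form
an independent set and those colored by a pair [s_j], [- s_j] induce an
antibalanced subgraph, the vertices colored [- s_j] being the switching set;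
conversely such classes can be colored in this way.  A class of the second kind
that is bipartite splits into two independent sets, which keeps [t + 2 * k] and
increases [t]; empty parts, when dropped, only lower [t + 2 * k].  So both
extremal problems have the same optimal pair [(t, k)]; the bound [t <= chi G]
costs nothing, because an ordinary coloring shows that the minimum of
[t + 2 * k] is at most [chi G]. *)

(** * Edges as pairs of distinct ends, and independent sets *)

Lemma endsP (G : mgraph) (e : edge G) : exists v w, ends e = [set v; w].
Proof.
have /eqP/cards2P[v [w [_ E]]] := card_ends e.
by exists v, w.
Qed.

(** This turns the counting condition in [switch] into a parity of memberships. It needs distinct
    ends, which looplessness provides. *)
Lemma card_set2I_eq1 (T : finType) (v w : T) (Y : {set T}) :
  v != w -> (#|[set v; w] :&: Y| == 1) = (v \in Y) (+) (w \in Y).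
Proof.
move=> vw; rewrite setIUl cardsU -!setIA.
have -> : [set v] :&: (Y :&: ([set w] :&: Y)) = set0.
  apply/setP=> x; rewrite !inE; case: eqP => // ->.
  by rewrite (negPf vw) /= andbF.
have card1I z : #|[set z] :&: Y| = (z \in Y).
  case zY: (z \in Y).
    by rewrite (setIidPl _) ?cards1 // sub1set.
  by apply/eqP; rewrite cards_eq0 setI_eq0 disjoints1 zY.
by rewrite !card1I cards0 subn0; case: (v \in Y); case: (w \in Y).
Qed.

Lemma independentP (G : mgraph) (X : {set vert G}) :
  reflect (forall (e : edge G) (v w : vert G),
             ends e = [set v; w] -> v \in X -> w \notin X)
          (independent X).
Proof.
apply: (iffP forallP) => [H e v w E vX | H e].
  by have := H e; rewrite E subUset !sub1set vX.
have [v [w E]] := endsP e; rewrite E subUset !sub1set negb_and -implybE.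
by apply/implyP; apply: H E.
Qed.

Lemma independent_sub (G : mgraph) (X Y : {set vert G}) :
  X \subset Y -> independent Y -> independent X.
Proof.
move=> XY /forallP H; apply/forallP=> e.
by apply: contra (H e) => /subset_trans; apply.
Qed.

(** * Induced subgraphs described inside the ambient graph *)

Section InducedSubgraph.
Variables (G : mgraph) (X : {set vert G}).

Lemma ends_inducedE (e : edge (induced X)) : ends (val e) = val @: ends e.
Proof.
apply/setP=> v; apply/idP/imsetP => [ve | [u]]; last by rewrite inE => ue ->.
by exists (Sub v (subsetP (valP e) v ve)); rewrite ?inE SubK.
Qed.

Lemma independent_induced (A : {set vert (induced X)}) :
  independent A = independent (val @: A).
Proof.
apply/forallP/forallP => H e; last first.
  by apply: contra (H (val e)) => eA; rewrite ends_inducedE imsetS.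
apply/negP=> eA; have eX : ends e \subset X.
  by apply: subset_trans eA _; apply/subsetP=> _ /imsetP[v _ ->]; apply: valP.
have /negP[] := H (Sub e eX); apply/subsetP=> v; rewrite inE SubK => ve.
by have /imsetP[u uA /val_inj->] := subsetP eA _ ve.
Qed.

Lemma bipartite_inducedP :
  reflect (exists A : {set vert G}, independent (X :&: A)
                                    /\ independent (X :\: A))
          (bipartite (induced X)).
Proof.
apply: (iffP existsP) => [[A /andP[iA iAC]] | [A [iA iAC]]].
  exists (val @: A); move: iA iAC; rewrite !independent_induced.
  move=> iA iAC; split; first exact: independent_sub (subsetIr _ _) iA.
  apply: independent_sub iAC; apply/subsetP=> v; rewrite inE => /andP[vA vX].
  apply/imsetP; exists (Sub v vX); rewrite ?SubK // inE.
  by apply: contra vA => vA; apply/imsetP; exists (Sub v vX); rewrite ?SubK.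
exists [set v | val v \in A]; rewrite !independent_induced.
apply/andP; split; [apply: independent_sub iA | apply: independent_sub iAC];
  by apply/subsetP=> _ /imsetP[v vA ->]; move: vA; rewrite !inE (valP v) ?andbT.
Qed.

(** Switching at [Y] flips exactly the edges crossing [Y], so all edges become negative precisely
    when the negative ones are those with both ends on the same side. *)
Lemma antibalanced_inducedP (sigma : signature G) :
  reflect (exists Y : {set vert G}, forall (e : edge G) (v w : vert G),
             ends e = [set v; w] -> v \in X -> w \in X ->
             sigma e = ((v \in Y) == (w \in Y)))
          (antibalanced (sig_induced X sigma)).
Proof.
apply: (iffP existsP) => [[Y /eqP/ffunP HY] | [Y HY]].
  exists (val @: Y) => e v w E vX wX.
  have eX : ends e \subset X by rewrite E subUset !sub1set vX.
  have := HY (Sub e eX); rewrite !ffunE SubK -(card_imset _ val_inj).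
  rewrite imsetI; last by move=> ? ? _ _; apply: val_inj.
  rewrite -ends_inducedE SubK E card_set2I_eq1 ?(ends_neq E) //.
  by case: (sigma e); case: (v \in _); case: (w \in _).
exists [set v | val v \in Y]; apply/eqP/ffunP=> e; rewrite !ffunE.
have [v [w E]] := endsP e; rewrite E card_set2I_eq1 ?(ends_neq E) //.
have E' : ends (val e) = [set val v; val w].
  by rewrite ends_inducedE E imsetU !imset_set1.
rewrite (HY _ _ _ E' (valP v) (valP w)) !inE.
by case: (_ \in Y); case: (_ \in Y).
Qed.

Lemma independent_bipartite_induced : independent X -> bipartite (induced X).
Proof.
move=> iX; apply/bipartite_inducedP; exists X; rewrite setIid setDv; split=> //.
exact: independent_sub (sub0set _) iX.
Qed.

End InducedSubgraph.

(** * Passage between partitions and symmetric colorings *)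

Section SymmetricColorings.
Variables (G : mgraph) (sigma : signature G).

Lemma sym_colorableP (t k : nat) :
  reflect (exists c : vert G -> std_symset t k,
             forall (e : edge G) (v w : vert G), ends e = [set v; w] ->
               c v <> sact (sigma e) (c w))
          (sym_colorable sigma t k).
Proof.
apply: (iffP existsP) => [[c /forallP H] | [c H]].
  exists c => e v w E; apply/eqP.
  by have /forallP/(_ v)/forallP/(_ w) := H e; rewrite E eqxx.
exists [ffun v => c v]; apply/forallP=> e; apply/forallP=> v; apply/forallP=> w.
by apply/implyP=> /eqP E; rewrite !ffunE; apply/eqP; apply: H.
Qed.

(** The sign of an edge acts only within a pair of opposite elements, so blocks with separate
    elements or pairs cannot conflict and only edges inside a block matter. *)
Lemma partition_sym_colorable (t k : nat) :
  has_partition sigma t k -> sym_colorable sigma t k.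
Proof.
case=> P [partP kindP <- <-]; apply/sym_colorableP.
set I := [set X in P | independent X].
set K := [set X in P | nonbip_antibalanced sigma X].
have [covP trivP _] := and3P partP.
have inP v : v \in pblock P v by rewrite mem_pblock (eqP covP) inE.
(* One switching set is chosen for each antibalanced block; sets outside [K] get the default
   [set0]. *)
have [Y HY] : exists Y : {set vert G} -> {set vert G}, forall X, X \in K ->
    forall (e : edge G) (v w : vert G), ends e = [set v; w] ->
      v \in X -> w \in X -> sigma e = ((v \in Y X) == (w \in Y X)).
  apply: (@fin_all_exists _ _ (fun X (Y : {set vert G}) => X \in K ->
    forall (e : edge G) (v w : vert G), ends e = [set v; w] ->
      v \in X -> w \in X -> sigma e = ((v \in Y) == (w \in Y)))) => X.
  case XK: (X \in K); last by exists set0.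
  move: XK; rewrite inE => /and3P[_ _ /antibalanced_inducedP[Y HY]].
  by exists Y.
pose R v (s : std_symset #|I| #|K|) := match s with
  | inl i => enum_val i = pblock P v
  | inr (j, b) => enum_val j = pblock P v /\ b = (v \in Y (pblock P v))
  end.
have [c cR] : exists c, forall v, R v (c v).
  apply: (@fin_all_exists _ _ R) => v.
  have vP : pblock P v \in P by rewrite pblock_mem // (eqP covP) inE.
  have /orP[iX | kX] := kindP _ vP.
    have XI : pblock P v \in I by rewrite inE vP.
    by exists (inl (enum_rank_in XI (pblock P v))); rewrite /= enum_rankK_in.
  have XK : pblock P v \in K by rewrite inE vP.
  exists (inr (enum_rank_in XK (pblock P v), v \in Y (pblock P v))).
  by rewrite /= enum_rankK_in.
exists c => e v w E; have := cR v; have := cR w; rewrite /R.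
case: (c w) => [i | [j b]] Rw; case: (c v) => [i' | [j' b']] Rv;
  rewrite /sact /=.
(* Equal self-inverse colors would put both ends of [e] in one independent block. *)
- rewrite if_same => -[eqi]; move: Rv; rewrite eqi Rw => eqP'.
  have := enum_valP i; rewrite Rw inE => /andP[_ /independentP].
  by move/(_ _ _ _ E); rewrite inP {1}eqP' inP => /(_ isT).
- by rewrite if_same.
- by case: (sigma e).
(* A conflict forces the same pair, hence the same block; there [sigma e] is negative exactly when
   the ends lie on the same side of [Y], that is, when their colors are equal rather than
   opposite. *)
case: Rw Rv => Ej -> [Ej' ->] eqc.
have eqj : j' = j by move: eqc; case: (sigma e) => -[].
have eqP' : pblock P w = pblock P v by rewrite -Ej -Ej' eqj.
have := enum_valP j; rewrite Ej => /HY/(_ _ _ _ E).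
rewrite inP {1}eqP' inP => /(_ isT isT) se; move: eqc; rewrite se -eqP'.
by case: (v \in _); case: (w \in _) => -[].
Qed.

(** The bound [k' <= k] is recorded because, once the two sums agree, it gives [t <= t']. *)
Lemma sym_colorable_partition (t k : nat) :
  sym_colorable sigma t k ->
  exists t' k', [/\ has_partition sigma t' k', t' + 2 * k' <= t + 2 * k
                  & k' <= k].
Proof.
case/sym_colorableP=> c cP.
pose pc j := [set v | if c v is inr (j', _) then j' == j else false].
pose bip := [set j | bipartite (induced (pc j))].
have [A HA] : exists A : 'I_k -> {set vert G}, forall j, j \in bip ->
    independent (pc j :&: A j) /\ independent (pc j :\: A j).
  apply: (@fin_all_exists _ _ (fun j (A : {set vert G}) => j \in bip ->
    independent (pc j :&: A) /\ independent (pc j :\: A))) => j.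
  case jB: (j \in bip); last by exists set0.
  by move: jB; rewrite inE => /bipartite_inducedP[A HA]; exists A.
(* The fibers of [f] will be the blocks: the sign within a pair is forgotten and, if the class of
   that pair is bipartite, replaced by the side of a bipartition. *)
pose f v : 'I_t + 'I_k * option bool := match c v with
  | inl i => inl i
  | inr (j, _) => inr (j, if j \in bip then Some (v \in A j) else None)
  end.
pose cl s := [set v | f v == s].
have cl_inl i : independent (cl (inl i)).
  apply/independentP=> e v w E; rewrite !inE /f.
  have := cP _ _ _ E; case: (c v) => [i1|[]//]; case: (c w) => [i2|[]//].
  rewrite /sact /= if_same => ne /eqP[eq1].
  by apply/eqP=> -[eq2]; case: ne; rewrite eq1 eq2.
have cl_some j b : j \in bip -> independent (cl (inr (j, Some b))).
  move=> jB; have [iA iAC] := HA j jB.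
  case: b; [apply: independent_sub iA | apply: independent_sub iAC];
    apply/subsetP=> v; rewrite !inE /f; case: (c v) => [//|[j' b]];
    by case: ifP => _ /eqP[] // -> ->; rewrite eqxx.
have cl_none j : j \notin bip -> cl (inr (j, None)) = pc j.
  move=> jB; apply/setP=> v; rewrite !inE /f; case: (c v) => [//|[j' b]].
  case: (j' =P j) => [->|ne]; first by rewrite (negPf jB) eqxx.
  by apply/eqP => -[].
have pc_anti j : antibalanced (sig_induced (pc j) sigma).
  apply/antibalanced_inducedP.
  exists [set v | if c v is inr (_, b) then b else false].
  move=> e v w E; have := cP _ _ _ E; rewrite !inE.
  case: (c v) => [//|[j1 b1]]; case: (c w) => [//|[j2 b2]] ne /eqP e1 /eqP e2.
  subst j1 j2; move: ne; rewrite /sact; case: (sigma e);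
    by case: b1; case: b2 => //= -[].
(* Only nonempty fibers occur as blocks, so the numbers of blocks are bounded above rather than
   computed exactly. *)
pose P := preim_partition f setT.
have partP : partition P setT by apply: preim_partitionP.
have Pcl X : X \in P -> exists v, X = cl (f v).
  case/imsetP=> v _ ->; exists v; apply/setP=> w.
  by rewrite !inE eq_sym.
have f_spec v : match f v with
    | inl _ => True
    | inr (j, Some _) => j \in bip
    | inr (j, None) => j \notin bip
    end.
  by rewrite /f; case: (c v) => [//|[j b]]; case: ifP => // ->.
have ind_excl X : independent X -> ~~ nonbip_antibalanced sigma X.
  by move/independent_bipartite_induced; rewrite /nonbip_antibalanced => ->.
have none_nb j : j \notin bip -> nonbip_antibalanced sigma (cl (inr (j, None))).
  by move=> jB; rewrite cl_none // /nonbip_antibalanced pc_anti andbT;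
    rewrite inE in jB.
set I := [set X in P | independent X].
set K := [set X in P | nonbip_antibalanced sigma X].
(* A block in [K] can only be the fiber over some [inr (j, None)], with [j] outside [bip]. *)
have cardK : #|K| <= #|~: bip|.
  apply: leq_trans (leq_imset_card (fun j => cl (inr (j, None))) _).
  apply/subset_leq_card/subsetP=> X; rewrite inE => /andP[/Pcl[v ->]].
  case: (f v) (f_spec v) => [i _ | [j [b|]] jB] nb.
  - by have := ind_excl _ (cl_inl i); rewrite nb.
  - by have := ind_excl _ (cl_some j b jB); rewrite nb.
  - by apply/imsetP; exists j; rewrite // inE.
(* Each self-inverse element gives at most one independent block and each bipartite pair class at
   most two. *)
have cardI : #|I| <= t + 2 * #|bip|.
  pose Ib b := [set cl (inr (j, Some b)) | j in bip].
  have cardIb b : #|Ib b| <= #|bip| by apply: leq_imset_card.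
  have card0 : #|[set cl (inl i) | i : 'I_t]| <= t.
    by apply: leq_trans (leq_imset_card _ _) _; rewrite card_ord.
  apply: (@leq_trans #|[set cl (inl i) | i : 'I_t] :|: (Ib true :|: Ib false)|).
    apply/subset_leq_card/subsetP=> X; rewrite inE => /andP[/Pcl[v ->]].
    case: (f v) (f_spec v) => [i _ | [j [b|]] jB] iX.
    - by apply/setUP; left; apply/imsetP; exists i.
    - have XIb : cl (inr (j, Some b)) \in Ib b by apply/imsetP; exists j.
      by case: b XIb {iX} => XIb; do 2!rewrite in_setU ?XIb ?orbT.
    - by have := ind_excl _ iX; rewrite none_nb.
  apply: leq_trans (leq_card_setU _ _) _; rewrite mul2n -addnn.
  apply: leq_add => //; apply: leq_trans (leq_card_setU _ _) _.
  exact: leq_add.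
have cardB : #|bip| + #|~: bip| = k by rewrite cardsC card_ord.
exists #|I|, #|K|; split; [|lia..].
exists P; split=> // X /Pcl[v ->].
case: (f v) (f_spec v) => [i _ | [j [b|]] jB].
- by rewrite cl_inl.
- by rewrite cl_some.
- by rewrite none_nb ?orbT.
Qed.

(** * The extremal numbers [chi_symt] and [chi_sym] *)

Lemma chi_symtP (t : nat) :
  exists2 k, chi_symt sigma t = t + 2 * k & sym_colorable sigma t k.
Proof.
rewrite /chi_symt; case: ex_minnP => n /existsP[k /andP[/eqP nk ck]] _.
by exists k.
Qed.

Lemma chi_symt_le (t k : nat) :
  sym_colorable sigma t k -> chi_symt sigma t <= t + 2 * k.
Proof.
move=> ck; rewrite /chi_symt; case: ex_minnP => n _; apply; apply/existsP.
have kP : k < (t + 2 * k).+1 by lia.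
by exists (Ordinal kP); rewrite eqxx.
Qed.

Lemma chi_sym_le_chi_symt (t : nat) :
  t <= chi G -> chi_sym sigma <= chi_symt sigma t.
Proof.
rewrite -ltnS => tP; rewrite /chi_sym -[t]/(val (Ordinal tP)).
elim: index_enum (mem_index_enum (Ordinal tP)) => //= s r IHr.
rewrite big_cons inE geq_min => /predU1P[<-|/IHr->]; last by rewrite orbT.
by rewrite leqnn.
Qed.

Lemma chi_symP :
  exists2 t, t <= chi G & chi_sym sigma = chi_symt sigma t.
Proof.
rewrite /chi_sym; elim/big_ind: _ => [|x y [t tP ->] [t' t'P ->]|t _].
- by exists 0.
- by rewrite /minn; case: ifP => _; [exists t | exists t'].
- by exists t; rewrite // -ltnS.
Qed.

(** Signs act trivially on self-inverse elements, so an ordinary proper coloring is a symmetric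
    one. *)
Lemma sym_colorable_chi : sym_colorable sigma (chi G) 0.
Proof.
rewrite /chi; case: ex_minnP => n /existsP[c /forallP cP] _.
apply/sym_colorableP; exists (fun v => inl (c v)) => e v w E.
rewrite /sact /= if_same => -[eqc].
have /forallP/(_ v)/forallP/(_ w) := cP e.
by rewrite E eqxx eqc eqxx.
Qed.

Lemma chi_sym_le_chi : chi_sym sigma <= chi G.
Proof.
apply: leq_trans (chi_sym_le_chi_symt (leqnn _)) _.
by have := chi_symt_le sym_colorable_chi; rewrite muln0 addn0.
Qed.

(** A value of [t] beyond the range of the minimum already exceeds [chi G], which bounds [chi_sym]
    from above. *)
Lemma chi_sym_le (t k : nat) :
  sym_colorable sigma t k -> chi_sym sigma <= t + 2 * k.
Proof.
move=> ck; have [tP|tP] := leqP t (chi G).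
  exact: leq_trans (chi_sym_le_chi_symt tP) (chi_symt_le ck).
by have := chi_sym_le_chi; lia.
Qed.

Lemma chi_symt_eq_chi_sym (t k : nat) :
  sym_colorable sigma t k -> t + 2 * k = chi_sym sigma ->
  t <= chi G /\ chi_symt sigma t = chi_sym sigma.
Proof.
move=> ck tk; have tP : t <= chi G by have := chi_sym_le_chi; lia.
by have := chi_symt_le ck; have := chi_sym_le_chi_symt tP; split=> //; lia.
Qed.

(** Splitting the bipartite classes of an optimal coloring cannot lower the sum below [chi_sym], so
    the sum is preserved and having at most as many pairs means having at least as many independent
    sets. *)
Lemma optimal_has_partition (t : nat) :
  t <= chi G -> chi_symt sigma t = chi_sym sigma ->
  exists t' k', [/\ has_partition sigma t' k', t' + 2 * k' = chi_sym sigma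
                  & t <= t'].
Proof.
move=> tP eqt; have [k tk /sym_colorable_partition] := chi_symtP t.
case=> t' [k' [P' le_tk le_k]]; have := chi_sym_le (partition_sym_colorable P').
by exists t', k'; split=> //; lia.
Qed.

End SymmetricColorings.

Theorem theorem3p5 (G : mgraph) (sigma : signature G) (t k : nat) :
  [/\ chi_sym sigma = t + 2 * k,
      t <= chi G,
      chi_symt sigma t = chi_sym sigma
    & forall t' : nat, t' <= chi G ->
        chi_symt sigma t' = chi_sym sigma -> t' <= t]
  <->
  [/\ has_partition sigma t k,
      forall t' k' : nat, has_partition sigma t' k' -> t + 2 * k <= t' + 2 * k'
    & forall t' k' : nat, has_partition sigma t' k' ->
        t' + 2 * k' = t + 2 * k -> t' <= t].
Proof.
split=> [[eq_tk tP eq_t maxt] | [Ptk mintk maxt]].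
  have maxP t' k' : has_partition sigma t' k' ->
      t' + 2 * k' = t + 2 * k -> t' <= t.
    move/partition_sym_colorable/chi_symt_eq_chi_sym=> eq_chi eq_tk'.
    by have [|t'P] := eq_chi; [rewrite eq_tk | apply: maxt].
  split=> // [|t' k' /partition_sym_colorable/chi_sym_le]; last by rewrite eq_tk.
  (* The partition obtained has at least [t] independent blocks; maximality leaves no room for more,
     so its parameters are exactly [t] and [k]. *)
  have [t' [k' [P' eq_tk' le_t]]] := optimal_has_partition tP eq_t.
  have le_t' : t' <= t by apply: maxP P' _; rewrite eq_tk' eq_tk.
  have -> : t = t' by lia.
  by have -> : k = k' by lia.
have eq_tk : chi_sym sigma = t + 2 * k.
  (* An index attaining [chi_sym] yields a partition whose sum is [chi_sym], and the minimality of
     [t + 2 * k] compares with it. *)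
  have [t0 t0P /esym eq_t0] := chi_symP sigma.
  have [t' [k' [/mintk le_tk eq_tk' _]]] := optimal_has_partition t0P eq_t0.
  have := chi_sym_le (partition_sym_colorable Ptk); lia.
have [tP eq_t] :=
  chi_symt_eq_chi_sym (partition_sym_colorable Ptk) (esym eq_tk).
split=> // t' t'P eq_t'.
(* An optimal coloring with [t'] self-inverse elements becomes an optimal partition with at least
   [t'] independent blocks, to which the maximality of [t] applies. *)
have [t'' [k'' [P'' eq_tk'' le_t]]] := optimal_has_partition t'P eq_t'.
by apply: leq_trans le_t (maxt _ _ P'' _); rewrite eq_tk''.
Qed.
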